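(* Let $\Sigma_1,\Sigma_2$ be signed graphs (with markings) of order $m$ whose $\mu$-signed graphs $\Sigma_{1\mu},\Sigma_{2\mu}$ are not adjacency-cospectral, have equal energy, and have the same coronal, $\chi_{A(\Sigma_{1\mu})}(x)=\chi_{A(\Sigma_{2\mu})}(x)$. Then for every signed graph $\Sigma$ (with marking) of order $n$, the signed graphs $\Sigma\circledast\Sigma_1$ and $\Sigma\circledast\Sigma_2$ are not adjacency-cospectral and have equal energy.
   Context: A signed graph is a triple $\Sigma=(S,\sigma,\mu)$ where $S=(V,E)$ is a finite simple undirected graph, $\sigma:E\to\{+1,-1\}$ is a signature and $\mu:V\to\{+1,-1\}$ is a marking. Its adjacency matrix $A(\Sigma)$ has $(i,j)$ entry $\sigma(u_iu_j)$ if $u_i\sim u_j$ and $0$ otherwise. The energy of $\Sigma$ is the sum of the absolute values of the eigenvalues of $A(\Sigma)$; two signed graphs are cospectral if their adjacency matrices have the same spectrum. The $\mu$-signed graph of $\Sigma$ is $\Sigma_\mu=(S,\sigma_\mu,\mu)$ with $\sigma_\mu(uv)=\mu(u)\mu(v)$. With $\mu(\Sigma)\in\{\pm1\}^m$ the vector of marks, the coronal is the rational function $\chi_{A(\Sigma_\mu)}(x)=\mu(\Sigma)^T(xI_m-A(\Sigma_\mu))^{-1}\mu(\Sigma)$. Product $\Sigma\circledast\Sigma'$ of signed graphs $\Sigma$ (vertices $u_1,\dots,u_{n}$, marking $\mu$) and $\Sigma'$ (vertices $v_1,\dots,v_{m}$, marking $\mu'$): vertices $a_{ij},b_{ij}$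 ($1\le i\le n$, $1\le j\le m$) with marks $\mu(u_i)$ on $a_{ij}$ and $\mu'(v_j)$ on $b_{ij}$; edges $a_{ik}a_{jl}$ for all $1\le k,l\le m$ whenever $u_iu_j\in E(\Sigma)$, $b_{ri}b_{rj}$ for all $1\le r\le n$ whenever $v_iv_j\in E(\Sigma')$, and $a_{ip}b_{iq}$ for all $i$ and all $1\le p,q\le m$; every edge $xy$ gets sign equal to the product of the marks of $x$ and $y$. *)

(* Defs.v *)
From HB Require Import structures.
From mathcomp Require Import all_boot all_order all_algebra.
From mathcomp Require Import fraction.

Set Implicit Arguments.
Unset Strict Implicit.
Unset Printing Implicit Defensive.

Import Order.TTheory GRing.Theory Num.Theory.
Local Open Scope ring_scope.

Definition is_sign (s : int) : bool := (s == 1) || (s == -1).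

(* The signature is a total function on pairs of vertices, but only its values
   on adjacent pairs are constrained or ever used. *)
Record sgraph (V : finType) := SGraph {
  sg_adj : rel V;
  sg_sign : V -> V -> int;
  sg_mark : V -> int;
  sg_adj_sym : symmetric sg_adj;
  sg_adj_irr : irreflexive sg_adj;
  sg_sign_sym : forall u v, sg_adj u v -> sg_sign u v = sg_sign v u;
  sg_signP : forall u v, sg_adj u v -> is_sign (sg_sign u v);
  sg_markP : forall u, is_sign (sg_mark u)
}.

Lemma is_signM (s t : int) : is_sign s -> is_sign t -> is_sign (s * t).
Proof. by move=> /orP[]/eqP-> /orP[]/eqP->. Qed.

Section MarkSigned.
Variables (V : finType) (adj : rel V) (mark : V -> int).
Hypotheses (adj_sym : symmetric adj) (adj_irr : irreflexive adj).
Hypothesis markP : forall u, is_sign (mark u).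

Lemma mark_sign_sym u v : adj u v -> mark u * mark v = mark v * mark u.
Proof. by rewrite mulrC. Qed.

Lemma mark_signP u v : adj u v -> is_sign (mark u * mark v).
Proof. by move=> _; apply: is_signM. Qed.

Definition mark_sgraph : sgraph V :=
  SGraph adj_sym adj_irr mark_sign_sym mark_signP markP.
End MarkSigned.

Definition mu_sgraph (V : finType) (G : sgraph V) : sgraph V :=
  mark_sgraph (sg_adj_sym G) (sg_adj_irr G) (sg_markP G).

(* Vertices of the product: inl (u_i, v_j) is a_ij and inr (u_i, v_j) is b_ij. *)
Section Product.
Variables (V W : finType) (G : sgraph V) (H : sgraph W).

Definition prod_vertex : finType := (V * W + V * W)%type.

Definition prod_adj (x y : prod_vertex) : bool :=
  match x, y with
  | inl a, inl a' => sg_adj G a.1 a'.1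
  | inr b, inr b' => (b.1 == b'.1) && sg_adj H b.2 b'.2
  | inl a, inr b => a.1 == b.1
  | inr b, inl a => a.1 == b.1
  end.

Definition prod_mark (x : prod_vertex) : int :=
  match x with
  | inl a => sg_mark G a.1
  | inr b => sg_mark H b.2
  end.

Lemma prod_adj_sym : symmetric prod_adj.
Proof.
move=> [a|b] [a'|b'] //=; first exact: sg_adj_sym.
by rewrite eq_sym sg_adj_sym.
Qed.

Lemma prod_adj_irr : irreflexive prod_adj.
Proof. by move=> [a|b] /=; rewrite sg_adj_irr ?andbF. Qed.

Lemma prod_markP x : is_sign (prod_mark x).
Proof. by case: x => [a|b]; apply: sg_markP. Qed.

Definition sg_prod : sgraph prod_vertex :=
  mark_sgraph prod_adj_sym prod_adj_irr prod_markP.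
End Product.

Definition adjmx (R : pzRingType) (V : finType) (G : sgraph V) : 'M[R]_#|V| :=
  \matrix_(i, j)
    if sg_adj G (enum_val i) (enum_val j)
    then (sg_sign G (enum_val i) (enum_val j))%:~R else 0.

Definition markmx (R : pzRingType) (V : finType) (G : sgraph V) : 'cV[R]_#|V| :=
  \col_i (sg_mark G (enum_val i))%:~R.

(* The eigenvalues, listed with (algebraic) multiplicity, in some order. *)
Definition eigenvalues (C : closedFieldType) (n : nat) (A : 'M[C]_n) : seq C :=
  sval (closed_field_poly_normal (char_poly A)).

Definition cospectral (C : closedFieldType) (V W : finType)
    (G : sgraph V) (H : sgraph W) : bool :=
  perm_eq (eigenvalues (adjmx C G)) (eigenvalues (adjmx C H)).

Definition energy (C : numClosedFieldType) (V : finType) (G : sgraph V) : C :=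
  \sum_(z <- eigenvalues (adjmx C G)) `|z|.

(* mu^T (x I - A)^-1 mu, computed in the field of rational functions F(x). *)
Definition coronal (F : fieldType) (V : finType) (G : sgraph V) :
    {fraction {poly F}} :=
  let K : fieldType := {fraction {poly F}} in
  let x : K := tofrac ('X : {poly F}) in
  ((markmx K G)^T *m invmx (x%:M - adjmx K G) *m markmx K G) 0 0.

(* Main.v *)
Require Import Defs.
From HB Require Import structures.
From mathcomp Require Import all_boot all_order all_algebra.
From mathcomp Require Import fraction.
From mathcomp Require Import perm mxtens.

Import Order.TTheory GRing.Theory Num.Theory.
Local Open Scope ring_scope.

(** Up to a relabelling of the vertices, the adjacency matrix of the product of
    [G] and [H] is the block matrix with blocks [M *t J], [S *t 1 nu^T],
    [S *t nu 1^T] and [I *t B], where [M] and [B] are the adjacency matrices of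
    the mu-signed graphs of [G] and [H], [S] is the diagonal matrix of the marks
    of [G] (so [S^2 = I]), [nu] is the vector of marks of [H] and [J] is the
    all-ones matrix.  Taking the Schur complement of the last block, over the
    field of rational functions, gives

      [char_poly (G * H) = char_poly B ^ n * det (x I - (M + chi I) *t J)]

    where [chi] is the coronal.  The second factor only depends on [G], on the
    order of [H] and on [chi], so that [P1 * f2 ^ n = P2 * f1 ^ n] for the
    characteristic polynomials [Pi] of the two products and [fi] of the two
    mu-signed graphs.  As an identity between multisets of eigenvalues this
    yields both claims. *)

(** A bijection forces [p = q], and the reindexing is then conjugation by a permutation matrix. *)
Lemma det_mxsub_bij (R : comPzRingType) (p q : nat) (h : 'I_p -> 'I_q)
    (A : 'M[R]_q) :
  bijective h -> \det (mxsub h h A) = \det A.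
Proof.
move=> bij_h; have := bij_eq_card bij_h; rewrite !card_ord => epq.
case: q / epq in h A bij_h *.
pose s := perm (bij_inj bij_h).
have -> : mxsub h h A = perm_mx s *m A *m perm_mx s^-1.
  rewrite -row_permE -col_permE.
  by apply/matrixP => i j; rewrite !mxE !permE.
by rewrite !det_mulmx mulrAC -det_mulmx -perm_mxM mulgV perm_mx1 det1 mul1r.
Qed.

Lemma det_castmx (R : comPzRingType) (p q : nat) (epq : p = q) (A : 'M[R]_p) :
  \det (castmx (epq, epq) A) = \det A.
Proof. by case: q / epq; rewrite castmx_id. Qed.

(** The tensor product is block diagonal with [n] copies of [B]; the induction splits off one
    block. *)
Lemma det_tens1mx (R : comPzRingType) (n m : nat) (B : 'M[R]_m) :
  \det ((1%:M : 'M[R]_n) *t B) = \det B ^+ n.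
Proof.
elim: n => [|n IHn]; first by rewrite det_mx00.
rewrite -[n.+1]/(1 + n)%N (scalar_mx_block 1 n) tens_block_mx.
rewrite det_castmx !tens0mx det_ublock IHn exprS.
by rewrite -[_%:M]/(1 : 'M_1) tens_scalar1mx det_castmx.
Qed.

Lemma tens11mx (R : comPzRingType) (n m : nat) :
  (1%:M : 'M[R]_n) *t (1%:M : 'M[R]_m) = 1%:M.
Proof.
apply/matrixP => i j.
case: (mxtens_indexP i) => i1 i2; case: (mxtens_indexP j) => j1 j2.
rewrite tensmxE !mxE (can_eq (@mxtens_indexK _ _)) xpair_eqE.
by rewrite -natrM mulnb.
Qed.

(** Multiplying on the right by the unitriangular [L] clears the lower left block and leaves the
    Schur complement in the upper left one. *)
Lemma det_schur (R : comPzRingType) (p q : nat) (A : 'M[R]_p)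
    (B : 'M[R]_(p, q)) (C : 'M[R]_(q, p)) (D D' : 'M[R]_q) :
  D *m D' = 1%:M ->
  \det (block_mx A B C D) = \det D * \det (A - B *m D' *m C).
Proof.
move=> DD'; pose L := block_mx 1%:M 0 (- (D' *m C)) 1%:M : 'M[R]_(p + q).
have detL : \det L = 1 by rewrite det_lblock !det1 mulr1.
rewrite -[LHS]mulr1 -detL -det_mulmx mulmx_block !mulmx0 !mulmx1 !add0r.
by rewrite !mulmxN !mulmxA DD' mul1mx subrr det_ublock mulrC.
Qed.

Section ProductCharPoly.
Variables (V W : finType) (G : sgraph V) (H : sgraph W).
Let n := #|V|.
Let m := #|W|.

Definition pair_of_index (k : 'I_(n * m)) : V * W :=
  (enum_val (mxtens_unindex k).1, enum_val (mxtens_unindex k).2).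

Definition index_of_pair (x : V * W) : 'I_(n * m) :=
  mxtens_index (enum_rank x.1, enum_rank x.2).

Lemma pair_of_indexK : cancel pair_of_index index_of_pair.
Proof.
move=> k; case: (mxtens_indexP k) => i j.
by rewrite /pair_of_index /index_of_pair mxtens_indexK /= !enum_valK.
Qed.

Lemma index_of_pairK : cancel index_of_pair pair_of_index.
Proof.
case=> u v; rewrite /pair_of_index /index_of_pair mxtens_indexK /=.
by rewrite !enum_rankK.
Qed.

(** The a-vertices come first, then the b-vertices, each half in the order of tensor indices. *)
Definition prod_vertex_of_index (k : 'I_(n * m + n * m)) : prod_vertex V W :=
  match split k with
  | inl i => inl (pair_of_index i)
  | inr i => inr (pair_of_index i)
  end.

Definition prod_rank (k : 'I_(n * m + n * m)) : 'I_#|prod_vertex V W| :=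
  enum_rank (prod_vertex_of_index k).

Lemma prod_rank_bij : bijective prod_rank.
Proof.
apply: (bij_comp (@enum_rank_bij _)).
exists (fun x : prod_vertex V W => match x with
  | inl a => lshift _ (index_of_pair a)
  | inr b => rshift _ (index_of_pair b) end).
  move=> k; rewrite /prod_vertex_of_index -{2}[k]splitK.
  by case: (split k) => i; rewrite pair_of_indexK.
case=> x; rewrite /prod_vertex_of_index.
  by rewrite (unsplitK (inl _)) index_of_pairK.
by rewrite (unsplitK (inr _)) index_of_pairK.
Qed.

Let marks_diag (R : pzRingType) : 'M[R]_n := diag_mx (markmx R G)^T.

Lemma mark_sqr (R : pzRingType) u :
  (sg_mark G u)%:~R * (sg_mark G u)%:~R = 1 :> R.
Proof. by case/orP: (sg_markP G u) => /eqP->; rewrite -intrM. Qed.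

Lemma marks_diag_sqr (R : comPzRingType) :
  marks_diag R *m marks_diag R = 1%:M.
Proof.
rewrite mulmx_diag; apply/matrixP => i j.
by rewrite !mxE mark_sqr.
Qed.

Lemma adjmx_sg_prod (R : comPzRingType) :
  mxsub prod_rank prod_rank (adjmx R (sg_prod G H)) =
  block_mx (adjmx R (mu_sgraph G) *t (const_mx 1 : 'M[R]_m))
           (marks_diag R *t ((const_mx 1 : 'cV[R]_m) *m (markmx R H)^T))
           (marks_diag R *t (markmx R H *m (const_mx 1 : 'rV[R]_m)))
           (1%:M *t adjmx R (mu_sgraph H)).
Proof.
apply/matrixP => i j; rewrite !mxE /prod_rank !enum_rankK /prod_vertex_of_index.
case: (split i) => {}i; rewrite !mxE; case: (split j) => {}j; rewrite !mxE /=.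
- by rewrite mulr1.
- rewrite big_ord1 !mxE mul1r (inj_eq enum_val_inj).
  by case: eqP => [->|_]; rewrite ?mul0r // mulr1n intrM.
- rewrite big_ord1 !mxE mulr1 (inj_eq enum_val_inj) eq_sym.
  by case: eqP => [->|_]; rewrite ?mul0r // mulr1n intrM mulrC.
- rewrite (inj_eq enum_val_inj).
  by case: eqP => _; rewrite ?mul0r ?mul1r.
Qed.

(** To be used with [x] the indeterminate, in the field of rational functions, where [chi] is the
    coronal. *)
Lemma det_sg_prod (K : fieldType) (x : K) :
    x%:M - adjmx K (mu_sgraph H) \in unitmx ->
  let chi := ((markmx K H)^T *m invmx (x%:M - adjmx K (mu_sgraph H))
                *m markmx K H) 0 0 in
  \det (x%:M - adjmx K (sg_prod G H)) =
  \det (x%:M - adjmx K (mu_sgraph H)) ^+ n *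
  \det (x%:M - (adjmx K (mu_sgraph G) + chi%:M) *t (const_mx 1 : 'M[K]_m)).
Proof.
set D := x%:M - _; move=> uD chi.
rewrite -(det_mxsub_bij _ _ _ _ _ prod_rank_bij).
have -> : mxsub prod_rank prod_rank (x%:M - adjmx K (sg_prod G H)) =
    x%:M - mxsub prod_rank prod_rank (adjmx K (sg_prod G H)).
  by apply/matrixP => i j; rewrite !mxE (inj_eq (bij_inj prod_rank_bij)).
rewrite adjmx_sg_prod scalar_mx_block opp_block_mx add_block_mx !add0r.
have -> : x%:M - 1%:M *t adjmx K (mu_sgraph H) = (1%:M : 'M_n) *t D.
  rewrite -[x]mulr1 -scale_scalar_mx -tens11mx.
  apply/matrixP => i j; rewrite /D !mxE mulrBr mulrCA.
  by congr (_ * _ - _); apply: mulr_natr.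
have invD : ((1%:M : 'M[K]_n) *t D) *m (1%:M *t invmx D) = 1%:M.
  by rewrite tensmx_mul mulmxV // mulmx1 tens11mx.
rewrite (det_schur _ _ _ _ _ _ _ _ invD) det_tens1mx; congr (_ * \det _).
(* The marks of [G] cancel in the correction term, which becomes the identity tensored with a
   multiple of the all-ones matrix. *)
rewrite mulNmx mulmxN mulNmx opprK !tensmx_mul mulmx1 marks_diag_sqr.
rewrite -!addrA -opprD; congr (_ - _).
have -> : const_mx 1 *m (markmx K H)^T *m invmx D *m (markmx K H *m const_mx 1)
    = chi *: (const_mx 1 : 'M[K]_m).
  (* The inner product of the marks through [invmx D] is a 1 by 1 matrix, hence the scalar [chi]. *)
  transitivity ((const_mx 1 : 'cV[K]_m) *m chi%:M *m (const_mx 1 : 'rV[K]_m)).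
    by rewrite -mx11_scalar !mulmxA.
  rewrite mul_mx_scalar -scalemxAl; congr (_ *: _).
  by apply/matrixP => i j; rewrite !mxE big_ord1 !mxE mulr1.
apply/matrixP => i j; rewrite !mxE mulrDl !mulr1; congr (_ + _).
exact: mulr_natl.
Qed.

End ProductCharPoly.

Lemma map_char_poly_mx (F : fieldType) (V : finType) (G : sgraph V) :
  map_mx (@tofrac {poly F}) (char_poly_mx (adjmx F G)) =
  (tofrac 'X)%:M - adjmx {fraction {poly F}} G.
Proof.
apply/matrixP => i j; rewrite !mxE rmorphB rmorphMn /=; congr (_ - _).
by case: ifP => _; rewrite ?rmorph_int ?rmorph0.
Qed.

Definition coronal_factor (F : fieldType) (V : finType) (G : sgraph V)
    (m : nat) (chi : {fraction {poly F}}) : {fraction {poly F}} :=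
  let K : fieldType := {fraction {poly F}} in
  \det ((tofrac 'X)%:M -
    (adjmx K (mu_sgraph G) + chi%:M) *t (const_mx 1 : 'M[K]_m)).

Lemma char_poly_sg_prod (F : fieldType) (V W : finType) (G : sgraph V)
    (H : sgraph W) :
  tofrac (char_poly (adjmx F (sg_prod G H))) =
  tofrac (char_poly (adjmx F (mu_sgraph H))) ^+ #|V| *
  coronal_factor F V G #|W| (coronal F (mu_sgraph H)).
Proof.
rewrite /char_poly -!det_map_mx !map_char_poly_mx det_sg_prod //.
(* Invertibility holds because the determinant is the image of a monic, hence nonzero,
   polynomial. *)
rewrite unitmxE -map_char_poly_mx det_map_mx unitfE tofrac_eq0.
exact: monic_neq0 (char_poly_monic _).
Qed.

Lemma prod_eigenvalues (C : closedFieldType) (n : nat) (A : 'M[C]_n) :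
  \prod_(z <- eigenvalues A) ('X - z%:P) = char_poly A.
Proof.
rewrite /eigenvalues; case: closed_field_poly_normal => s /=.
by rewrite (monicP (char_poly_monic A)) scale1r.
Qed.

Lemma prod_XsubC_flatten_nseq (R : comNzRingType) (n : nat) (s : seq R) :
  \prod_(z <- flatten (nseq n s)) ('X - z%:P) =
  (\prod_(z <- s) ('X - z%:P)) ^+ n.
Proof.
elim: n => [|n IHn]; first by rewrite big_nil.
by rewrite exprS -IHn -big_cat.
Qed.

(** Repetition multiplies every count by [n], which can be cancelled when positive. *)
Lemma perm_flatten_nseq (T : eqType) (n : nat) (s t : seq T) :
  (0 < n)%N -> perm_eq (flatten (nseq n s)) (flatten (nseq n t)) = perm_eq s t.
Proof.
move=> n_gt0.
have countE u a : count a (flatten (nseq n u)) = (n * count a u)%N.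
  by rewrite count_flatten map_nseq sumn_nseq mulnC.
apply/idP/idP => /seq.permP st; apply/seq.permP => a;
  last by rewrite !countE st.
by apply/eqP; rewrite -(eqn_pmul2l n_gt0) -!countE st.
Qed.

(** The products of linear factors over both lists equal [f1 ^ n * f2 ^ n] times the common coronal
    factor, and a product of monic linear factors determines its roots with multiplicity. *)
Lemma perm_eigenvalues_sg_prod (C : closedFieldType) (V V1 V2 : finType)
    (G : sgraph V) (G1 : sgraph V1) (G2 : sgraph V2) :
    #|V1| = #|V2| ->
    coronal C (mu_sgraph G1) = coronal C (mu_sgraph G2) ->
  perm_eq
    (eigenvalues (adjmx C (sg_prod G G1)) ++
       flatten (nseq #|V| (eigenvalues (adjmx C (mu_sgraph G2)))))
    (eigenvalues (adjmx C (sg_prod G G2)) ++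
       flatten (nseq #|V| (eigenvalues (adjmx C (mu_sgraph G1))))).
Proof.
move=> card12 coronal12.
apply: prod_XsubC_eq; rewrite !big_cat /= !prod_XsubC_flatten_nseq.
rewrite !prod_eigenvalues; apply/eqP; rewrite -tofrac_eq !rmorphM !rmorphXn /=.
rewrite !char_poly_sg_prod coronal12.
have -> : coronal_factor C V G #|V1| = coronal_factor C V G #|V2|.
  by rewrite card12.
by rewrite mulrAC [X in _ == X]mulrAC [X in X * _]mulrC.
Qed.

Theorem theorem8 (C : numClosedFieldType) (m : nat) (V1 V2 : finType)
    (Sigma1 : sgraph V1) (Sigma2 : sgraph V2)
    (order1 : #|V1| = m) (order2 : #|V2| = m)
    (noncospectral : ~ cospectral C (mu_sgraph Sigma1) (mu_sgraph Sigma2))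
    (equienergetic : energy C (mu_sgraph Sigma1) = energy C (mu_sgraph Sigma2))
    (same_coronal : coronal C (mu_sgraph Sigma1) = coronal C (mu_sgraph Sigma2))
    (n : nat) (V : finType) (Sigma : sgraph V)
    (n_gt0 : (0 < n)%N) (order : #|V| = n) :
  ~ cospectral C (sg_prod Sigma Sigma1) (sg_prod Sigma Sigma2) /\
  energy C (sg_prod Sigma Sigma1) = energy C (sg_prod Sigma Sigma2).
Proof.
have eq_spec := perm_eigenvalues_sg_prod C V V1 V2 Sigma Sigma1 Sigma2
  (etrans order1 (esym order2)) same_coronal.
rewrite order in eq_spec; split.
  (* Cancelling equal spectra of the products would leave [n] copies of each factor spectrum, equal
     as multisets. *)
  move=> cosp; apply: noncospectral; rewrite /cospectral perm_sym.
  rewrite -(perm_flatten_nseq _ n) //.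
  rewrite -(perm_cat2l (eigenvalues (adjmx C (sg_prod Sigma Sigma1)))).
  by apply: perm_trans eq_spec _; rewrite perm_cat2r perm_sym.
have energy_flatten (s : seq C) :
    \sum_(z <- flatten (nseq n s)) `|z| = (\sum_(z <- s) `|z|) *+ n.
  elim: n {order eq_spec n_gt0} => [|k IHk]; first by rewrite big_nil.
  by rewrite mulrS -IHk -big_cat.
have perm_sum (s t : seq C) :
    perm_eq s t -> \sum_(z <- s) `|z| = \sum_(z <- t) `|z|.
  exact: perm_big.
(* Summing absolute values adds [n] times the same energy to each side, which cancels. *)
have := perm_sum _ _ eq_spec.
rewrite !big_cat /= !energy_flatten -!/(energy _ _) equienergetic.
exact: addIr.
Qed.
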